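(* Let $a<b$ be real and $c=(a+b)/2$. Let $\beta_2=\sqrt3$ and $\alpha_2=(b-a)/(2\sqrt3)$. Amongst all monic quadratic polynomials $\phi$ with real coefficients, $\phi(x)=(x-c)^2-\alpha_2^2$ is the unique minimizer of the optimal error constant $K_2(\phi)$ (defined in the context). This choice gives, for every $f:[a,b]\to\mathbb{R}$ such that $f'$ is absolutely continuous on $[a,b]$ and $f''\in L^2([a,b])$, the quadrature formula $$\int_a^b f(x)\,dx=\frac{b-a}{2}\left[f(a)+f(b)\right]+\frac{(b-a)^2}{12}\left[f'(a)-f'(b)\right]+E(f),$$ where $|E(f)|\le \|f''\|_2(b-a)^{5/2}/(12\sqrt5)$, and this error estimate is optimal: the coefficient $(b-a)^{5/2}/(12\sqrt5)$ of $\|f''\|_2$ cannot be replaced by any smaller constant valid for all such $f$.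
   Context: $\|\cdot\|_2$ is the $L^2([a,b])$ norm. For a monic quadratic polynomial $\phi$ with real coefficients and $f$ with $f'$ absolutely continuous on $[a,b]$, define $E_\phi(f)$ by $$\int_a^b f(x)\,dx=\tfrac12\left[-f(a)\phi'(a)+f(b)\phi'(b)+f'(a)\phi(a)-f'(b)\phi(b)\right]+E_\phi(f);$$ integration by parts gives $E_\phi(f)=\tfrac12\int_a^b f''(x)\phi(x)\,dx$. The optimal error constant is $$K_2(\phi)=\sup\{|E_\phi(f)| : f' \text{ absolutely continuous on } [a,b],\ f''\in L^2([a,b]),\ \|f''\|_2\le 1\}.$$ In the quadrature formula, $E(f)=E_\phi(f)$ for the stated $\phi$. *)

(* Defs.v *)
From HB Require Import structures.
From mathcomp Require Import all_boot all_order all_algebra.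
From mathcomp Require Import all_classical all_reals all_analysis.
Set Implicit Arguments.
Unset Strict Implicit.
Unset Printing Implicit Defensive.
Import Order.TTheory GRing.Theory Num.Theory.
Import numFieldNormedType.Exports.
Local Open Scope classical_set_scope.
Local Open Scope ring_scope.

(* Functions on [a, b] are total functions R -> R; every notion below depends
   only on their values on [a, b]. In particular derivatives are taken within
   [a, b], hence are one-sided at a and b. *)

Section quadrature.
Context {R : realType}.
Implicit Types (a b : R) (f g : R -> R) (phi : {poly R}).

Definition diff_quotient f (x y : R) : R := (f y - f x) / (y - x).

Definition differentiable_on a b f : Prop :=
  forall x, x \in `[a, b] ->
    cvg (diff_quotient f x y @[y --> within `[a, b] x^']).

(* Where the limit does not exist the value is irrelevant: for f' absolutely
   continuous, this happens for the derivative of f' only on a null set. *)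
Definition deriv_on a b f (x : R) : R :=
  lim (diff_quotient f x y @[y --> within `[a, b] x^']).

Definition absolutely_continuous_on a b g : Prop :=
  forall e : R, 0 < e -> exists2 d : R, 0 < d &
    forall (n : nat) (u v : 'I_n -> R),
      (forall i, [/\ a <= u i, u i <= v i & v i <= b]) ->
      trivIset [set: 'I_n] (fun i => [set` `]u i, v i[]) ->
      \sum_(i < n) (v i - u i) < d ->
      \sum_(i < n) `|g (v i) - g (u i)| < e.

(* Extension by zero outside [a, b]: the L^2 space and norm of the library are
   those of the whole line. *)
Definition in_L2 a b g : Prop :=
  (g \_ `[a, b]) \in Lfun (@lebesgue_measure R) 2%:E.

Definition L2norm a b g : \bar R :=
  'N[@lebesgue_measure R]_(2%:E)[EFin \o (g \_ `[a, b])].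

Definition admissible a b f : Prop :=
  [/\ differentiable_on a b f,
      absolutely_continuous_on a b (deriv_on a b f) &
      in_L2 a b (deriv_on a b (deriv_on a b f))].

Definition L2norm_deriv2 a b f : \bar R :=
  L2norm a b (deriv_on a b (deriv_on a b f)).

Definition monic_quadratic phi : Prop := phi \is monic /\ size phi = 3%N.

Definition quad_error a b phi f : R :=
  \int[@lebesgue_measure R]_(x in `[a, b]) f x -
  2^-1 * (- f a * phi^`().[a] + f b * phi^`().[b]
          + deriv_on a b f a * phi.[a] - deriv_on a b f b * phi.[b]).

Definition K2 a b phi : \bar R :=
  ereal_sup [set `|quad_error a b phi f|%:E | f in
    [set f | admissible a b f /\ (L2norm_deriv2 a b f <= 1)%E]].

Definition K2_minimizer a b phi : Prop :=
  monic_quadratic phi /\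
  forall psi : {poly R}, monic_quadratic psi -> (K2 a b phi <= K2 a b psi)%E.

End quadrature.

(* Main.v *)
(* With g = f', the function f phi' - g phi is absolutely continuous with derivative
   2 f - f'' phi almost everywhere, so E_phi(f) is half the integral of f'' phi. By
   Cauchy-Schwarz, with equality when f'' is proportional to phi, K_2(phi) is half the
   L^2 norm of phi. For phi = (x - c)^2 + p (x - c) + q and h = (b - a)/2 the squared
   norm is 8 h^5/45 + 2 h^3 p^2/3 + 2 h (q + h^2/3)^2, which is minimal exactly when
   p = 0 and q = - h^2/3.

   The integration of f'' needs the fundamental theorem of calculus for absolutely
   continuous functions: such a function is a difference of two nondecreasing ones
   (the total variation is absolutely continuous), the Lebesgue-Stieltjes measure of a
   nondecreasing absolutely continuous function has a Radon-Nikodym density, and the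
   function is differentiable with this derivative at the Lebesgue points. *)
Require Import Defs.
From HB Require Import structures.
From mathcomp Require Import all_boot all_order all_algebra.
From mathcomp Require Import all_classical all_reals all_analysis.
From mathcomp Require Import ring lra.
Import Order.TTheory GRing.Theory Num.Theory.
Import numFieldNormedType.Exports.
Local Open Scope classical_set_scope.
Local Open Scope ring_scope.

Set Implicit Arguments.
Unset Strict Implicit.
Unset Printing Implicit Defensive.

(** * Absolute continuity and total variation *)
Section abs_cont.
Context {R : realType}.
Implicit Types (a b : R) (f g : R -> R) (s : seq (R * R)).

(** Common endpoints are allowed, so that consecutive cells of a partition are separated. A
    degenerate pair in the interior of another interval is not separated from it. *)
Definition separated (p q : R * R) : bool := (p.2 <= q.1) || (q.2 <= p.1).

Definition itv_family a b s : bool :=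
  all (fun p => [&& a <= p.1, p.1 <= p.2 & p.2 <= b]) s && pairwise separated s.

Definition family_length s : R := \sum_(p <- s) (p.2 - p.1).

Definition family_variation f s : R := \sum_(p <- s) `|f p.2 - f p.1|.

(* Lists of pairs instead of the ordinal-indexed families of
   [absolutely_continuous_on]: they can be concatenated and refined. *)
Definition abs_cont a b f : Prop := forall e : R, 0 < e -> exists2 d : R, 0 < d &
  forall s, itv_family a b s -> family_length s < d -> family_variation f s < e.

Lemma separatedC : symmetric separated.
Proof. by move=> p q; rewrite /separated orbC. Qed.

Lemma family_length_ge0 a b s : itv_family a b s -> 0 <= family_length s.
Proof.
case/andP=> /allP sab _; rewrite /family_length big_seq sumr_ge0// => p ps.
by have /and3P[_ + _] := sab _ ps; rewrite subr_ge0.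
Qed.

Lemma absolutely_continuous_on_abs_cont a b f :
  absolutely_continuous_on a b f -> abs_cont a b f.
Proof.
move=> fac e /fac[d d0 H]; exists d => // s /andP[/allP sab sep] sd.
pose u (i : 'I_(size s)) := (nth (0, 0) s i).1.
pose v (i : 'I_(size s)) := (nth (0, 0) s i).2.
have -> : family_variation f s = \sum_(i < size s) `|f (v i) - f (u i)|.
  by rewrite /family_variation (big_nth (0, 0)) big_mkord.
apply: H; first 2 last.
- by move: sd; rewrite /family_length (big_nth (0, 0)) big_mkord.
- by move=> i; have /and3P[] := sab _ (mem_nth (0, 0) (ltn_ord i)).
- apply/trivIsetP => i j _ _ ij; rewrite -subset0 => x [] /=.
  rewrite !in_itv/= => /andP[ux xv] /andP[ux' xv'].
  suff : separated (nth (0, 0) s i) (nth (0, 0) s j).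
    by move=> /orP[|] h; [move: (lt_le_trans xv h)|move: (lt_le_trans xv' h)];
      rewrite ltNge ltW.
  move/(pairwiseP (0, 0)) : sep => sep.
  move: ij; rewrite neq_ltn => /orP[ij|ij]; last rewrite separatedC;
    by apply: sep => //; rewrite inE.
Qed.

Lemma abs_cont_sub a b c d f : a <= c -> d <= b ->
  abs_cont a b f -> abs_cont c d f.
Proof.
move=> ac db fac e /fac[r r0 H]; exists r => // s /andP[/allP sab sep]; apply: H.
apply/andP; split=> //; apply/allP => p /sab /and3P[h1 -> h2].
by rewrite (le_trans ac h1) (le_trans h2 db).
Qed.

Lemma abs_contB a b f g : abs_cont a b f -> abs_cont a b g ->
  abs_cont a b (fun x => f x - g x).
Proof.
move=> fac gac e e0; have e20 : 0 < e / 2 by rewrite divr_gt0.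
have [d d0 fd] := fac _ e20; have [d' d'0 gd] := gac _ e20.
exists (Num.min d d'); first by rewrite lt_min d0.
move=> s sab; rewrite lt_min => /andP[sd sd'].
rewrite [e]splitr; apply: le_lt_trans (ltrD (fd _ sab sd) (gd _ sab sd')).
rewrite /family_variation -big_split/=; apply: ler_sum => p _.
by rewrite opprD addrACA -opprD (le_trans (ler_normB _ _)).
Qed.

Lemma abs_contM_of_bound a b f g (M : R) :
  (forall x, a <= x <= b -> `|f x| <= M) -> (forall x, a <= x <= b -> `|g x| <= M) ->
  abs_cont a b f -> abs_cont a b g -> abs_cont a b (fun x => f x * g x).
Proof.
move=> fM gM fac gac e e0.
(* [M] may be 0, and negative when [[a, b]] is empty; [K] is a bound by which one can divide. *)
pose K := Num.max M 0 + 1.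
have K0 : 0 < K by rewrite ltr_wpDl// le_max lexx orbT.
have MK : M <= K by rewrite (@le_trans _ _ (Num.max M 0)) ?le_max ?lexx// lerDl.
have eK0 : 0 < e / 2 / K by rewrite !divr_gt0.
have [d d0 fd] := fac _ eK0; have [d' d'0 gd] := gac _ eK0.
exists (Num.min d d'); first by rewrite lt_min d0.
move=> s sab; rewrite lt_min => /andP[sd sd'].
have : K * (family_variation f s + family_variation g s) < e.
  by rewrite mulrC -ltr_pdivlMr// [e]splitr mulrDl ltrD ?fd ?gd.
apply: le_lt_trans; rewrite /family_variation -big_split mulr_sumr/=.
rewrite big_seq [leRHS]big_seq; apply: ler_sum => p ps.
move: sab => /andP[/allP/(_ _ ps)/and3P[h1 h2 h3] _].
(* Discrete product rule: each increment is weighted by a value that [K] bounds. *)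
have -> : f p.2 * g p.2 - f p.1 * g p.1 =
  (f p.2 - f p.1) * g p.2 + f p.1 * (g p.2 - g p.1) by ring.
rewrite (le_trans (ler_normD _ _))// [leRHS]mulrDr !normrM lerD//.
  by rewrite mulrC ler_wpM2r// (le_trans (gM _ _))// h3 (le_trans h1).
by rewrite ler_wpM2r// (le_trans (fM _ _))// h1 (le_trans h2).
Qed.

Lemma lipschitz_absolutely_continuous_on a b f (K : R) :
  (forall x y, a <= x -> x <= y -> y <= b -> `|f y - f x| <= K * (y - x)) ->
  absolutely_continuous_on a b f.
Proof.
move=> fK e e0; pose M := Num.max K 0 + 1.
have M0 : 0 < M by rewrite ltr_wpDl// le_max lexx orbT.
have KM : K <= M by rewrite (@le_trans _ _ (Num.max K 0)) ?le_max ?lexx// lerDl.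
exists (e / M) => [|n u v uv _]; first by rewrite divr_gt0.
rewrite ltr_pdivlMr// mulrC; apply: le_lt_trans; rewrite mulr_sumr.
apply: ler_sum => i _; have [h1 h2 h3] := uv i.
by rewrite (le_trans (fK _ _ h1 h2 h3))// ler_wpM2r// subr_ge0.
Qed.

Lemma lipschitz_abs_cont a b f (K : R) :
  (forall x y, a <= x -> x <= y -> y <= b -> `|f y - f x| <= K * (y - x)) ->
  abs_cont a b f.
Proof.
by move=> /lipschitz_absolutely_continuous_on/absolutely_continuous_on_abs_cont.
Qed.

(** * Total variation of absolutely continuous functions *)

(** Zipping the list of nodes with its tail gives the cells of the partition, since [zip] truncates
    the longer list; their lengths telescope. *)
Lemma partition_family (u v : R) (s0 : seq R) : itv_partition u v s0 -> u <= v ->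
  itv_family u v (zip (u :: s0) s0) /\ family_length (zip (u :: s0) s0) = v - u.
Proof.
elim: s0 u => [|x s0 ih] u.
  by case=> _ /= /eqP <- _; rewrite /family_length big_nil subrr.
case=> /= /andP[ux xs] lv uv.
have xv : x <= v by rewrite -(eqP lv); apply: unstable.path_lt_le_last.
have [/andP[/allP h1 h2] h3] := ih x (conj xs lv) xv.
split; last by rewrite /family_length big_cons/= -[X in _ + X]/(family_length _) h3 addrC subrKA.
rewrite /itv_family /= lexx (ltW ux) xv /= h2 andbT; apply/andP; split.
  by apply/allP => p /h1/and3P[+ -> ->]; rewrite !andbT; apply: le_trans (ltW ux).
by apply/allP => p /h1/and3P[p1 _ _]; rewrite /separated/= p1.
Qed.

Lemma variation_family (u v : R) f (s0 : seq R) :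
  variation u v f s0 = family_variation f (zip (u :: s0) s0).
Proof.
rewrite /variation /family_variation.
elim: s0 u => [|x s0 ih] u; first by rewrite !big_nil.
by rewrite [RHS]big_cons [LHS]big_nat_recl//= ih.
Qed.

(* Replacing an interval of a family by a partition of it gives again a family of
   the same total length, so the bound on variations passes to total variations. *)
Lemma sum_total_variation_le a b f (e d : R) :
  (forall s, itv_family a b s -> family_length s < d -> family_variation f s < e) ->
  forall s, itv_family a b s -> family_length s < d ->
    (\sum_(p <- s) total_variation p.1 p.2 f <= e%:E)%E.
Proof.
move=> H s.
suff G s' : itv_family a b (s ++ s') -> family_length (s ++ s') < d ->
    (\sum_(p <- s) total_variation p.1 p.2 f + (family_variation f s')%:E <= e%:E)%E.
  move=> sab sd; have := G [::]; rewrite cats0 => /(_ sab sd).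
  by rewrite /family_variation big_nil adde0.
elim: s s' => [|[u v] s ih] s' sab sd.
  by rewrite big_nil add0e lee_fin ltW// H.
rewrite big_cons /=.
move: (sab) => /andP[/= /andP[/and3P[au uv vb]]].
rewrite !all_cat pairwise_cat => /andP[hs hs'] /and3P[/andP[us us'] ss' /andP[ps ps']].
have T0 p : p \in s -> (0 <= total_variation p.1 p.2 f)%E.
  by move=> pin; apply: total_variation_ge0; have /and3P[] := allP hs _ pin.
have S0 : (0 <= \sum_(p <- s) total_variation p.1 p.2 f)%E.
  by rewrite big_seq; apply: sume_ge0 => p /T0.
(* Finiteness allows the sum to be moved across an inequality in [\bar R]; it follows from the
   induction hypothesis with an empty accumulator. *)
have Sfin : (\sum_(p <- s) total_variation p.1 p.2 f \is a fin_num).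
  rewrite ge0_fin_numE// (@le_lt_trans _ _ e%:E) ?ltry//.
  have := ih [::]; rewrite cats0 /family_variation big_nil adde0; apply.
    by rewrite /itv_family hs.
  apply: le_lt_trans sd; rewrite /family_length big_cons big_cat/=.
  have : 0 <= family_length s'.
    by apply: (@family_length_ge0 a b); rewrite /itv_family hs'.
  by rewrite /family_length; move: uv; lra.
rewrite -addeA -leeBrDr ?fin_numD ?Sfin//.
(* The total variation of the head is a supremum over partitions. For each of them, the cells [z]
   move to the accumulator. *)
apply: ge_ereal_sup => _ [_ [s0 pars0 <-] <-].
rewrite leeBrDr ?fin_numD ?Sfin// variation_family.
set z := zip _ _.
have [/andP[/allP hz pz] lz] := partition_family pars0 uv.
rewrite addeCA -EFinD.
have -> : family_variation f z + family_variation f s' = family_variation f (z ++ s').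
  by rewrite /family_variation big_cat.
apply: ih.
  rewrite /itv_family !all_cat hs hs' !pairwise_cat ps pz ps' !andbT /=.
  apply/andP; split; first by apply/allP => p /hz/and3P[h1 -> h3];
    rewrite (le_trans au h1) (le_trans h3 vb).
  have zs t : (forall q, q \in t -> separated (u, v) q) -> allrel separated t z.
    move=> tuv; apply/allrelP => q p /tuv + /hz/and3P[h1 h2 h3].
    rewrite /separated /= => /orP[h|h].
      by rewrite (le_trans h3 h) orbT.
    by rewrite (le_trans h h1).
  rewrite allrel_catr ss' zs/=; last exact/allP.
  apply/allrelP => p q pz' qs'; rewrite separatedC.
  by have /allrelP := zs s' (allP us'); apply.
by move: sd lz; rewrite /family_length -/z !big_cat big_cons/= => + ->; lra.
Qed.

(** With [e = 1], the total variation is at most 1 on every interval shorter than [d], and finitely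
    many steps of length [d / 2] lead from [a] to [x]. *)
Lemma abs_cont_total_variation_lty a b f x : abs_cont a b f ->
  a <= x <= b -> (total_variation a x f < +oo)%E.
Proof.
move=> fac; have [d d0 H] := fac 1 ltr01.
have small u v : a <= u -> u <= v -> v <= b -> v - u < d ->
    (total_variation u v f <= 1)%E.
  move=> au uv vb uvd.
  have := @sum_total_variation_le a b f 1 d H [:: (u, v)].
  by rewrite /itv_family /family_length !big_seq1/= au uv vb; apply.
have key n : forall y, a <= y <= b -> y - a <= n%:R * (d / 2) ->
    (total_variation a y f < +oo)%E.
  elim: n => [|n ih] y /andP[ay yb] yn.
    have -> : y = a by apply/eqP; rewrite eq_le ay andbT -subr_le0 (le_trans yn)// mul0r.
    by rewrite total_variationxx ltry.
  (* One step back from [y], stopped at [a]. *)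
  pose z := Num.max a (y - d / 2).
  have d20 : 0 < d / 2 by rewrite divr_gt0.
  have az : a <= z by rewrite le_max lexx.
  have zy : z <= y by rewrite ge_max ay/= gerBl ltW.
  have yz : y - d / 2 <= z by rewrite le_max lexx orbT.
  rewrite (total_variationD f az zy) lte_add_pinfty//.
    apply: ih; first by rewrite az (le_trans zy).
    rewrite lerBlDr ge_max lerDr mulr_ge0 ?(ltW d20)//=.
    by move: yn; rewrite -natr1 mulrDl mul1r; lra.
  rewrite (@le_lt_trans _ _ 1%E) ?ltry// small//.
  by move: yz d0; lra.
move=> /andP[ax xb]; apply: (key (Num.bound ((x - a) / (d / 2)))); first by rewrite ax.
by rewrite -ler_pdivrMr ?divr_gt0// ltW// archi_boundP// divr_ge0 ?subr_ge0// ltW// divr_gt0.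
Qed.

Lemma abs_cont_total_variation_fin_num a b f x y : abs_cont a b f ->
  a <= x -> x <= y -> y <= b -> total_variation x y f \is a fin_num.
Proof.
move=> fac ax xy yb; rewrite ge0_fin_numE ?total_variation_ge0//.
by rewrite (@abs_cont_total_variation_lty x b)// ?xy//; exact: abs_cont_sub fac.
Qed.

Lemma fine_total_variationB a b f x y : abs_cont a b f ->
  a <= x -> x <= y -> y <= b ->
  fine (total_variation a y f) - fine (total_variation a x f) =
  fine (total_variation x y f).
Proof.
move=> fac ax xy yb; rewrite (total_variationD f ax xy) fineD.
- by rewrite addrC addKr.
- by rewrite (abs_cont_total_variation_fin_num fac)// (le_trans xy).
- by rewrite (abs_cont_total_variation_fin_num fac).
Qed.

Lemma abs_cont_total_variation a b f : abs_cont a b f ->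
  abs_cont a b (fun x => fine (total_variation a x f)).
Proof.
(* Suprema turn the strict bound into a weak one, hence the margin [e / 2]. *)
move=> fac e e0; have e20 : 0 < e / 2 by rewrite divr_gt0.
have [d d0 H] := fac _ e20; exists d => // s sab sd.
apply: (@le_lt_trans _ _ (e / 2)); last by rewrite ltr_pdivrMr// ltr_pMr// ltr1n.
rewrite -lee_fin; apply: le_trans (sum_total_variation_le H sab sd).
rewrite /family_variation -sumEFin big_seq [leRHS]big_seq; apply: lee_sum => p ps.
move: sab => /andP[/allP/(_ _ ps)/and3P[h1 h2 h3] _].
rewrite (fine_total_variationB fac)// ger0_norm ?fine_ge0 ?total_variation_ge0//.
by rewrite fineK// (abs_cont_total_variation_fin_num fac).
Qed.

Lemma norm_le_fine_total_variation a b f x y : abs_cont a b f ->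
  a <= x -> x <= y -> y <= b -> `|f y - f x| <= fine (total_variation x y f).
Proof.
move=> fac ax xy yb; rewrite -lee_fin fineK ?total_variation_ge//.
by rewrite (abs_cont_total_variation_fin_num fac).
Qed.

Lemma abs_cont_bounded a b f : abs_cont a b f ->
  exists M, forall x, a <= x <= b -> `|f x| <= M.
Proof.
move=> fac; exists (`|f a| + fine (total_variation a b f)) => x /andP[ax xb].
rewrite -(subrK (f a) (f x)) addrC (le_trans (ler_normD _ _))// lerD2l.
rewrite (le_trans (norm_le_fine_total_variation fac (lexx a) ax xb))//.
rewrite -subr_ge0 (fine_total_variationB fac)//.
by rewrite fine_ge0// total_variation_ge0.
Qed.

Lemma abs_cont_nondecreasing_decomposition a b f : abs_cont a b f ->
  exists g h : R -> R, [/\ abs_cont a b g, abs_cont a b h,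
    {in `[a, b] &, nondecreasing_fun g}, {in `[a, b] &, nondecreasing_fun h} &
    forall x, f x = g x - h x].
Proof.
move=> fac; pose V x := fine (total_variation a x f).
have Vac : abs_cont a b V := abs_cont_total_variation fac.
(* Jordan decomposition: [V - f] is nondecreasing because an increment of [f] is at most the
   variation, that is, the increment of [V]. *)
exists V, (fun x => V x - f x); split => //.
- exact: abs_contB.
- move=> x y /[!in_itv]/= /andP[ax _] /andP[_ yb] xy.
  rewrite -subr_ge0 (fine_total_variationB fac)//.
  by rewrite fine_ge0// total_variation_ge0.
- move=> x y /[!in_itv]/= /andP[ax _] /andP[_ yb] xy.
  have := norm_le_fine_total_variation fac ax xy yb.
  rewrite -(fine_total_variationB fac ax xy yb) -/(V y) -/(V x) ler_norml.
  by move=> /andP[_]; lra.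
- by move=> x; rewrite opprB addrC subrK.
Qed.

End abs_cont.

(** * The fundamental theorem of calculus for absolutely continuous functions *)
Section lebesgue_stieltjes.
Context {R : realType}.
Implicit Types (a b : R) (f g : R -> R).
Notation mu := (@lebesgue_measure R).

Lemma lebesgue_stieltjes_measure_itvoc (G : cumulative R R) (x y : R) : x <= y ->
  lebesgue_stieltjes_measure G `]x, y] = (G y - G x)%:E.
Proof.
move=> xy; rewrite /lebesgue_stieltjes_measure /measure_extension.
by rewrite measurable_mu_extE/= ?wlength_itv_bnd//; exact: is_ocitv.
Qed.

(** The endpoints are the infimum and the supremum: openness excludes both from [I], and the
    interval property fills the gap between them. The empty set is written as a degenerate
    interval. *)
Lemma open_interval_subset_itvoo (I : set R) a b : a <= b ->
  open I -> is_interval I -> I `<=` `]a, b[ ->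
  exists p : R * R, [&& a <= p.1, p.1 <= p.2 & p.2 <= b] /\ I = `]p.1, p.2[%classic.
Proof.
move=> ab oI iI Iab; have [->|/set0P[x0 Ix0]] := eqVneq I set0.
  by exists (a, a); rewrite /= lexx ab; split => //; rewrite set_itv_ge// bnd_simp ltxx.
have lI : has_lbound I by exists a => x /Iab; rewrite /= in_itv/= => /andP[/ltW].
have uI : has_ubound I by exists b => x /Iab; rewrite /= in_itv/= => /andP[_ /ltW].
have I0 : I !=set0 by exists x0.
exists (inf I, sup I); split => /=.
  apply/and3P; split.
  - by apply: lb_le_inf => // x /Iab; rewrite /= in_itv/= => /andP[/ltW].
  - by apply: (@le_trans _ _ x0); [exact: ge_inf|exact: ub_le_sup].
  - by apply: ge_sup => // x /Iab; rewrite /= in_itv/= => /andP[_ /ltW].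
apply/seteqP; split => x.
  move=> Ix; have [e /= e0 eI] := oI x Ix.
  have e20 : 0 < e / 2 by rewrite divr_gt0.
  have e2e : e / 2 < e by rewrite ltr_pdivrMr// ltr_pMr// ltr1n.
  rewrite /= in_itv/=; apply/andP; split.
    apply: (@le_lt_trans _ _ (x - e / 2)); last by rewrite ltrBlDr ltrDl.
    by apply: ge_inf => //; apply: eI; rewrite /= opprB addrC subrK gtr0_norm.
  apply: (@lt_le_trans _ _ (x + e / 2)); first by rewrite ltrDl.
  by apply: ub_le_sup => //; apply: eI; rewrite /= opprD addNKr normrN gtr0_norm.
rewrite /= in_itv/= => /andP[ix xs].
have [y Iy yx] : exists2 y, I y & y < x.
  have := @inf_adherent _ I (x - inf I); rewrite subr_gt0 ix => /(_ isT).
  by rewrite addrC subrK => /(_ (conj I0 lI)).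
have [z Iz xz] : exists2 z, I z & x < z.
  have := @sup_adherent _ I (sup I - x); rewrite subr_gt0 xs => /(_ isT).
  by rewrite opprB addrC subrK => /(_ (conj I0 uI)).
by apply: (iI y z) => //; rewrite (ltW yx) ltW.
Qed.

(** Outer regularity encloses [A] in an open set [U] of measure less than [d]. The components of [U]
    within []a, b[] are disjoint intervals of total length less than [d], so any finitely many of
    them carry a variation of [G] less than [e]. *)
Lemma lebesgue_stieltjes_measure_abs_cont0 (G : cumulative R R) a b (A : set R) :
  a < b -> abs_cont a b G -> measurable A -> mu A = 0%E ->
  lebesgue_stieltjes_measure G (A `&` `]a, b[) = 0%E.
Proof.
move=> ab Gac mA A0.
pose nu : {measure set (measurableTypeR R) -> \bar R} := lebesgue_stieltjes_measure G.
rewrite -[LHS]/(nu _).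
apply/eqP; rewrite eq_le measure_ge0 andbT; apply/lee_addgt0Pr => e e0; rewrite add0e.
have [d d0 H] := Gac _ e0.
have Aoo : (mu A < +oo)%E by rewrite A0 ltry.
have [U [oU AU UAd]] := lebesgue_regularity_outer mA Aoo d0.
have oO : open (U `&` `]a, b[) by apply: openI => //; exact: interval_open.
pose I := open_disjoint_itv oO.
have OI : U `&` `]a, b[ = \bigcup_n I n  := @open_disjoint_itv_bigcup _ _ oO.
have oI n : open (I n) := @open_disjoint_itv_open _ _ oO n.
have mI n : measurable (I n) by exact: measurable_realfun.open_measurable.
have tI : trivIset setT I  := @open_disjoint_itv_trivIset _ _ oO.
have Iab n : I n `<=` `]a, b[.
  by move=> x Inx; have : (\bigcup_n I n) x by [exists n]; rewrite -OI => -[].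
have /choice[p /all_and2[pab Ip]] : forall n, exists q : R * R,
    [&& a <= q.1, q.1 <= q.2 & q.2 <= b] /\ I n = `]q.1, q.2[%classic.
  move=> n; apply: open_interval_subset_itvoo => //; first exact: ltW.
  exact: open_disjoint_itv_is_interval.
have muI n : mu (I n) = ((p n).2 - (p n).1)%:E.
  have /and3P[_ p12 _] := pab n.
  rewrite Ip lebesgue_measure_itv/= lte_fin; case: ltP => // p21.
  by rewrite (_ : (p n).2 = (p n).1) ?subrr//; apply/eqP; rewrite eq_le p12 p21.
have nuI n : (nu (I n) <= (G (p n).2 - G (p n).1)%:E)%E.
  have /and3P[_ p12 _] := pab n.
  rewrite -lebesgue_stieltjes_measure_itvoc// le_measure ?inE//; rewrite Ip//.
  exact: subset_itv_oo_oc.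
have mO : measurable (U `&` `]a, b[) by rewrite OI; exact: bigcupT_measurable.
have muO : (mu (U `&` `]a, b[) < d%:E)%E.
  apply: (@le_lt_trans _ _ (mu U)).
    by rewrite le_measure ?inE//; exact: measurable_realfun.open_measurable.
  rewrite (measureDI mu (measurable_realfun.open_measurable oU) mA).
  have -> : U `&` A = A by apply/seteqP; split=> [x []//|x Ax]; split=> //; exact: AU.
  by have : (mu (U `\` A) + mu A < d%:E)%E by rewrite A0 adde0.
apply: (@le_trans _ _ (nu (U `&` `]a, b[))).
  rewrite le_measure ?inE//; first exact: measurableI.
  by apply: setSI.
rewrite OI (@measure_semi_bigcup _ R _ nu I)//; last by rewrite -OI.
(* Absolute continuity concerns finite families, so the series of measures is bounded through its
   partial sums. *)
apply: lime_le; first by apply: is_cvg_nneseries => n _ _; exact: measure_ge0.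
apply: nearW => n.
(* Degenerate pairs are dropped: the one chosen for an empty component might lie inside another
   interval and spoil separation. *)
pose s := [seq p i | i <- iota 0 n & (p i).1 < (p i).2].
have sab : itv_family a b s.
  apply/andP; split; first by apply/allP => q /mapP[i _ ->].
  rewrite pairwise_map; apply: (@sub_in_pairwise _ (fun i => (p i).1 < (p i).2)
      (fun i j => i != j)); last 2 first.
  - exact: filter_all.
  - by rewrite -uniq_pairwise filter_uniq// iota_uniq.
  move=> i j; rewrite -!topredE/= => pi pj ij; rewrite /separated.
  apply: contraT; rewrite negb_or -!ltNge => /andP[h1 h2].
  move: pi pj h1 h2; case: (p i) (p j) (Ip i) (Ip j) => [x y] [x' y'] /= Ii Ij.
  move=> xy xy' x'y yx'; have /trivIsetP/(_ i j Logic.I Logic.I ij) := tI.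
  (* Two intervals that are not separated overlap, and the midpoint of the overlap contradicts
     disjointness. *)
  rewrite Ii Ij -subset0 => /(_ ((Num.max x x' + Num.min y y') / 2)) h; exfalso; apply: h.
  have mM : Num.max x x' < Num.min y y' by rewrite lt_min !gt_max xy xy' x'y yx'.
  have xM : x <= Num.max x x' by rewrite le_max lexx.
  have xM' : x' <= Num.max x x' by rewrite le_max lexx orbT.
  have yM : Num.min y y' <= y by rewrite ge_min lexx.
  have yM' : Num.min y y' <= y' by rewrite ge_min lexx orbT.
  move: (Num.max x x') (Num.min y y') mM xM xM' yM yM' => M m mM xM xM' yM yM'.
  by split; rewrite /= in_itv/=; apply/andP; split; lra.
have slen : family_length s < d.
  rewrite -lte_fin; apply: le_lt_trans muO.
  rewrite /family_length big_map big_filter -sumEFin.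
  rewrite OI measure_semi_bigcup//; last by rewrite -OI.
  apply: le_trans (nneseries_lim_ge n (fun n _ _ => measure_ge0 _ _)).
  rewrite /index_iota subn0 big_mkcond/=; apply: lee_sum => i _.
  by rewrite muI; case: ifPn => //; have /and3P[_ + _] := pab i; rewrite lee_fin subr_ge0.
have := H _ sab slen; rewrite -lte_fin => /ltW; apply: le_trans.
rewrite /family_variation big_map big_filter -sumEFin.
rewrite /index_iota subn0 [leRHS]big_mkcond/=; apply: lee_sum => i _.
rewrite (le_trans (nuI i))//; case: ifPn => [_|]; first by rewrite lee_fin ler_norm.
have /and3P[_ p12 _] := pab i.
by rewrite -leNgt => p21; rewrite (@le_anti _ _ (p i).1 (p i).2) ?subrr// p12.
Qed.

(** Composition with this projection onto [[a, b]] extends a function by constants, as a cumulative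
    function must be defined on the whole line. *)
Definition clamp a b (x : R) : R := Num.min b (Num.max a x).

Lemma clamp_itv a b x : a <= b -> a <= clamp a b x <= b.
Proof. by move=> ab; rewrite /clamp le_min ab le_max lexx/= ge_min lexx. Qed.

Lemma clamp_id a b x : a <= x <= b -> clamp a b x = x.
Proof. by rewrite /clamp => /andP[ax xb]; rewrite (max_idPr ax) (min_idPr xb). Qed.

Lemma clamp_nondecreasing a b : {homo clamp a b : x y / x <= y}.
Proof.
move=> x y xy; rewrite /clamp le_min ge_min lexx/= ge_min ge_max !le_max lexx/=.
by rewrite xy !orbT.
Qed.

Lemma clamp_contraction a b x y : a <= b -> x <= y ->
  clamp a b y - clamp a b x <= y - x.
Proof.
move=> ab xy; rewrite /clamp /Num.min /Num.max.
by case: ifPn; case: ifPn; case: ifPn; case: ifPn; rewrite -?leNgt; lra.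
Qed.

(** The projection is nondecreasing and does not increase lengths, so it maps a family of separated
    intervals to one in [[a, b]] that is no longer. *)
Lemma abs_cont_clamp a b c d f : a <= b -> abs_cont a b f ->
  abs_cont c d (f \o clamp a b).
Proof.
move=> ab fac e /fac[r r0 H]; exists r => // s /andP[/allP scd sep] sr.
pose t := [seq (clamp a b p.1, clamp a b p.2) | p <- s].
have -> : family_variation (f \o clamp a b) s = family_variation f t.
  by rewrite /family_variation big_map.
apply: H; last first.
  apply: le_lt_trans sr; rewrite /family_length big_map big_seq [leRHS]big_seq.
  by apply: ler_sum => p /scd/and3P[_ p12 _]; exact: clamp_contraction.
apply/andP; split.
  apply/allP => _ /mapP[p /scd/and3P[_ p12 _] ->] /=.
  have /andP[-> _] := clamp_itv p.1 ab; have /andP[_ ->] := clamp_itv p.2 ab.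
  by rewrite clamp_nondecreasing.
rewrite pairwise_map; apply: sub_pairwise sep => p q.
rewrite /relpre/= /separated/= => /orP[|] h; apply/orP; [left|right];
  exact: clamp_nondecreasing.
Qed.

Lemma abs_cont_right_continuous f : (forall a b, abs_cont a b f) ->
  right_continuous f.
Proof.
move=> fac x; apply/cvgrPdist_lt => e e0.
have [d d0 H] := fac x (x + 1) e e0.
near=> y; rewrite distrC.
have xy : x <= y by near: y; exact: nbhs_right_ge.
have := H [:: (x, y)]; rewrite /itv_family /family_length /family_variation.
rewrite !big_seq1/= xy lexx/= !andbT; apply.
  by near: y; apply: nbhs_right_le; rewrite ltrDl.
by rewrite ltrBlDr addrC; near: y; apply: nbhs_right_lt; rewrite ltrDl.
Unshelve. all: by end_near. Qed.

Lemma nondecreasing_abs_cont_primitive a b f : a <= b -> abs_cont a b f ->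
  {in `[a, b] &, nondecreasing_fun f} ->
  exists2 h : R -> R, mu.-integrable `[a, b] (EFin \o h) &
    forall x, a <= x <= b -> \int[mu]_(t in `[a, x]) h t = f x - f a.
Proof.
move=> ab fac fnd; pose G0 := f \o clamp a b.
have G0nd : nondecreasing G0.
  move=> x y xy; apply: fnd; rewrite ?in_itv/= ?clamp_itv//.
  exact: clamp_nondecreasing.
have G0rc : right_continuous G0.
  by apply: abs_cont_right_continuous => c d; exact: abs_cont_clamp.
pose Gmix := isCumulative.Build R _ R G0 G0nd G0rc.
pose G : cumulative R R := HB.pack G0 Gmix.
have Gac c d : abs_cont c d G by exact: abs_cont_clamp.
pose nu : {measure set (measurableTypeR R) -> \bar R} := lebesgue_stieltjes_measure G.
(* Restriction to a bounded interval makes the measure finite; the margin 1 keeps []a, x]] inside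
   [D] even for [x = b]. *)
pose D : set (measurableTypeR R) := `]a - 1, b + 1[%classic.
have mD : measurable D by exact: measurable_itv.
have ab1 : a - 1 < b + 1 by lra.
have nuD : (nu D < +oo)%E.
  apply: (@le_lt_trans _ _ (nu `]a - 1, b + 1]%classic)).
    by rewrite le_measure ?inE//; exact: subset_itv_oo_oc.
  by rewrite [nu _]lebesgue_stieltjes_measure_itvoc ?ltry// ltW.
pose nuD' : {finite_measure set (measurableTypeR R) -> \bar R} := mfrestr mD nuD.
have nuDE (A : set R) : nuD' A = nu (A `&` D) by [].
have dom : nuD' `<< mu.
  apply/null_content_dominatesP => A mA A0; rewrite nuDE.
  exact: lebesgue_stieltjes_measure_abs_cont0.
have [g [g0 gfin gint gE]] := radon_nikodym_sigma_finite dom.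
have gfE : EFin \o (fine \o g) = g by apply/funext => x /=; rewrite fineK.
have hint A : measurable A -> mu.-integrable A (EFin \o (fine \o g)).
  by move=> mA; rewrite gfE; apply: integrableS gint.
exists (fine \o g); first exact: hint.
move=> x /andP[ax xb].
(* Half-open intervals are those whose Stieltjes measure is the increment of [G]; the point [a] does
   not affect the Lebesgue integral. *)
rewrite -Rintegral_itv_obnd_cbnd; last exact: hint.
have -> : f x - f a = G x - G a by rewrite /G/= /G0/= !clamp_id ?lexx ?ab ?ax.
have -> : \int[mu]_(t in `]a, x]) (fine \o g) t = fine (nuD' `]a, x]%classic).
  by congr fine; rewrite gE; [apply: eq_integral => t _; rewrite /= fineK|exact: measurable_itv].
rewrite nuDE.
rewrite setIidl; last by apply: subset_itv; rewrite bnd_simp; lra.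
by rewrite [nu _]lebesgue_stieltjes_measure_itvoc.
Qed.

Lemma abs_cont_primitive a b f : a <= b -> abs_cont a b f ->
  exists2 h : R -> R, mu.-integrable `[a, b] (EFin \o h) &
    forall x, a <= x <= b -> \int[mu]_(t in `[a, x]) h t = f x - f a.
Proof.
move=> ab /abs_cont_nondecreasing_decomposition[u [v [uac vac und vnd fE]]].
have [g gi gE] := nondecreasing_abs_cont_primitive ab uac und.
have [h hi hE] := nondecreasing_abs_cont_primitive ab vac vnd.
exists (g \- h) => [|x /[dup] axb /andP[ax xb]].
  by rewrite (_ : EFin \o _ = (EFin \o g) \- (EFin \o h))%E//; exact: integrableB.
have S : `[a, x] `<=` `[a, b] by apply: subset_itvl; rewrite bnd_simp.
rewrite RintegralB//; [|exact: integrableS gi|exact: integrableS hi].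
by rewrite gE// hE// !fE; ring.
Qed.

(** The density is the derivative of its indefinite integral at each of its Lebesgue points, hence
    almost everywhere. At interior points this derivative is two-sided. *)
Lemma abs_cont_FTC a b f : a < b -> abs_cont a b f ->
  exists h : R -> R, [/\ mu.-integrable `[a, b] (EFin \o h),
    \int[mu]_(t in `[a, b]) h t = f b - f a &
    {ae mu, forall x, `]a, b[%classic x -> is_derive x 1 f (h x)}].
Proof.
move=> ab fac; have [h hi hE] := abs_cont_primitive (ltW ab) fac.
exists h; split=> //; first by rewrite hE// lexx ltW.
have hi' : mu.-integrable [set: R] (EFin \o (h \_ `[a, b])).
  by rewrite -restrict_EFin; apply/integrable_restrict; rewrite ?setTI.
have := integrable_locally_restrict (measurable_itv `[a, b]) hi.
move/lebesgue_differentiation; apply: filterS; first exact: (ae_filter_ringOfSetsType mu).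
move=> x hx; rewrite /= in_itv/= => /andP[ax xb].
pose F y := \int[mu]_(t in `[a, y]) (h \_ `[a, b]) t.
have [||dF F'] := @FTC1_lebesgue_pt R (h \_ `[a, b]) (BLeft a) x b xb _ _ hx.
- exact: integrableS hi'.
- by rewrite lte_fin.
have xab : x \in `[a, b] by rewrite in_itv/= !ltW.
have hxE : (h \_ `[a, b]) x = h x by rewrite patchE mem_set.
have : is_derive x 1 F (h x) by split => //; rewrite -derive1E F'.
move=> dFx.
(* Near [x], [f] coincides with [F + f a] and inherits its derivative. *)
have : is_derive x 1 (F \+ cst (f a)) (h x + 0) by apply: is_deriveD.
rewrite addr0; apply: near_eq_is_derive.
near=> y.
have ayb : a <= y <= b.
  suff : y \in `]a, b[ by rewrite in_itv/= => /andP[ay yb]; rewrite !ltW.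
  by near: y; apply: near_in_itvoo; rewrite in_itv/= ax.
rewrite /= /F -[RHS](subrK (f a)) -hE//; congr (_ + _).
apply: eq_Rintegral => t; rewrite inE/= in_itv/= => /andP[at_ ty].
rewrite patchE mem_set//= in_itv/= at_/=.
by move/andP: ayb => [_]; apply: le_trans.
Unshelve. all: by end_near. Qed.

End lebesgue_stieltjes.

(** * Derivatives within a closed interval *)
Section deriv_on.
Context {R : realType}.
Implicit Types (a b x l : R) (f g : R -> R) (p : {poly R}).

(** Properness makes limits within [[a, b]] unique, so that [deriv_on] can be computed. Points close
    to [x] are found on its right if [x < b], and on its left if [x = b]. *)
Lemma within_itv_dnbhs_proper a b x : a < b -> x \in `[a, b] ->
  ProperFilter (within `[a, b] x^').
Proof.
move=> ab; rewrite in_itv/= => /andP[ax xb]; apply: Build_ProperFilter.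
rewrite /within /dnbhs /= => -[e /= e0 H].
have e20 : 0 < e / 2 by rewrite divr_gt0.
have e2e : e / 2 < e by rewrite ltr_pdivrMr// ltr_pMr// ltr1n.
have [xltb|bx] := ltP x b.
  apply: (H (Num.min (x + e / 2) b)).
  - rewrite /= distrC ger0_norm ?subr_ge0 ?le_min ?xb ?lerDl ?(ltW e20)//.
    by rewrite ltrBlDl gt_min ltrD2l e2e.
  - by rewrite gt_eqF// lt_min xltb ltrDl e20.
  - rewrite /= in_itv/= ge_min lexx orbT andbT le_min (ltW ab) andbT.
    by rewrite (le_trans ax)// lerDl ltW.
have {}xb : x = b by apply/eqP; rewrite eq_le xb.
apply: (H (Num.max (x - e / 2) a)).
- rewrite /= ger0_norm ?subr_ge0 ?ge_max ?ax ?gerBl ?(ltW e20)//.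
  by rewrite ltrBlDl -ltrBlDr lt_max ltrD2l ltrN2 e2e.
- by rewrite lt_eqF// gt_max xb ab gtrBl e20.
- rewrite /= in_itv/= le_max lexx orbT/= ge_max (ltW ab) andbT -xb.
  by rewrite gerBl ltW.
Qed.

Lemma deriv_onE a b f x l : a < b -> x \in `[a, b] ->
  diff_quotient f x y @[y --> within `[a, b] x^'] --> l -> deriv_on a b f x = l.
Proof.
move=> ab xab fl; rewrite /deriv_on.
have ? := within_itv_dnbhs_proper ab xab.
exact: cvg_lim.
Qed.

Lemma eq_diff_quotient_cvg a b f g x l : {in `[a, b], f =1 g} -> x \in `[a, b] ->
  diff_quotient f x y @[y --> within `[a, b] x^'] --> l ->
  diff_quotient g x y @[y --> within `[a, b] x^'] --> l.
Proof.
move=> fg xab; apply: cvg_trans; apply: near_eq_cvg.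
suff : \forall y \near x^', `[a, b]%classic y -> diff_quotient f x y = diff_quotient g x y.
  by [].
by apply: nearW => y yab; rewrite /diff_quotient !fg.
Qed.

Lemma is_derive_diff_quotient_cvg a b f x l : is_derive x 1 f l ->
  diff_quotient f x y @[y --> within `[a, b] x^'] --> l.
Proof.
move=> /is_derive1_caratheodory[g [fE gc gx]].
apply: (@cvg_within_filter _ _ _ _ _).
have := gc; rewrite -gx => /continuous_withinNx; apply: cvg_trans.
apply: near_eq_cvg; near=> y.
have yx : y != x by near: y; exact: nbhs_dnbhs_neq.
by rewrite /diff_quotient fE mulfK// subr_eq0.
Unshelve. all: by end_near. Qed.

Lemma diff_quotient_cvg_is_derive a b f x l : x \in `]a, b[ ->
  diff_quotient f x y @[y --> within `[a, b] x^'] --> l -> is_derive x 1 f l.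
Proof.
move=> xab fl; apply/is_derive1_caratheodory.
(* Caratheodory's slope function: the difference quotient, completed by [l] at [x]. *)
exists (fun z => if z == x then l else diff_quotient f x z); split; last by rewrite eqxx.
- move=> z; case: eqP => [->|/eqP zx]; first by rewrite !subrr mulr0.
  by rewrite /diff_quotient divfK// subr_eq0.
apply/continuous_withinNx; rewrite eqxx; apply/cvgrPdist_lt => e e0.
move/cvgrPdist_lt : fl => /(_ e e0); rewrite near_withinE => fl.
near=> y.
have yx : y != x by near: y; exact: nbhs_dnbhs_neq.
rewrite (negbTE yx); have : y \in `[a, b] -> `|l - diff_quotient f x y| < e.
  by near: y.
apply; suff : y \in `]a, b[ by apply: subset_itv_oo_cc.
by near: y; apply: nbhs_dnbhs; exact: near_in_itvoo.
Unshelve. all: by end_near. Qed.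

Lemma differentiable_on_cvg a b f x : differentiable_on a b f -> x \in `[a, b] ->
  diff_quotient f x y @[y --> within `[a, b] x^'] --> deriv_on a b f x.
Proof. by move=> fd /fd. Qed.

Lemma differentiable_on_continuous a b f : differentiable_on a b f ->
  {within `[a, b], continuous f}.
Proof.
move=> fd; apply/subspace_continuousP => x xab.
have fl := differentiable_on_cvg fd xab.
have : diff_quotient f x y * (y - x) @[y --> within `[a, b] x^'] -->
    deriv_on a b f x * (x - x).
  apply: cvgM => //; apply: cvgB; last exact: cvg_cst.
  apply: cvg_within_filter; apply: cvg_within_filter; exact: cvg_id.
rewrite subrr mulr0 => /cvgrPdist_lt H; apply/cvgrPdist_lt => e e0.
have := H _ e0; rewrite !near_withinE; apply: filterS => y Hy yab.
have [->|yx] := eqVneq y x; first by rewrite subrr normr0.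
have := Hy yx yab; rewrite /diff_quotient divfK ?subr_eq0//.
by rewrite sub0r normrN distrC.
Qed.

Lemma differentiable_on_is_derive a b f x : differentiable_on a b f -> x \in `]a, b[ ->
  is_derive x 1 f (deriv_on a b f x).
Proof.
move=> fd xab; apply: (@diff_quotient_cvg_is_derive a b) => //.
by apply: differentiable_on_cvg => //; exact: subset_itv_oo_cc.
Qed.

Lemma differentiable_on_lipschitz a b f (K : R) : differentiable_on a b f ->
  (forall x, a <= x <= b -> `|deriv_on a b f x| <= K) ->
  forall x y, a <= x -> x <= y -> y <= b -> `|f y - f x| <= K * (y - x).
Proof.
move=> fd fK x y ax xy yb.
have [c cxy ->] : exists2 c, c \in `[x, y] & f y - f x = deriv_on a b f c * (y - x).
  apply: MVT_segment => // [z zxy|].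
    apply: differentiable_on_is_derive => //.
    by apply: subset_itv zxy; rewrite bnd_simp.
  apply: continuous_subspaceW (differentiable_on_continuous fd).
  by apply: subset_itv; rewrite bnd_simp.
rewrite normrM [X in _ * X]ger0_norm ?subr_ge0// ler_wpM2r ?subr_ge0//.
by apply: fK; move: cxy; rewrite in_itv/= => /andP[xc cy]; rewrite (le_trans ax)// (le_trans cy).
Qed.

Lemma horner_bounded a b p : exists M, forall x, a <= x <= b -> `|p.[x]| <= M.
Proof.
have [ba|ab] := ltP b a.
  by exists 0 => x /andP[ax xb]; move: (le_trans ax xb); rewrite leNgt ba.
have cn : {within `[a, b], continuous (fun x => `|p.[x]|)}.
  apply: continuous_subspaceT => x; apply: continuous_comp; last exact: norm_continuous.
  exact: continuous_horner.
have [c _ cM] := EVT_max ab cn.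
by exists `|p.[c]| => x axb; apply: cM; rewrite in_itv.
Qed.

Lemma diff_quotient_horner_cvg a b p x :
  diff_quotient (horner p) x y @[y --> within `[a, b] x^'] --> p^`().[x].
Proof. exact: is_derive_diff_quotient_cvg. Qed.

Lemma differentiable_on_horner a b p : differentiable_on a b (horner p).
Proof. by move=> x _; apply/cvg_ex; exists p^`().[x]; exact: diff_quotient_horner_cvg. Qed.

Lemma deriv_on_horner a b p : a < b ->
  {in `[a, b], deriv_on a b (horner p) =1 horner p^`()}.
Proof. by move=> ab x xab; apply: deriv_onE => //; exact: diff_quotient_horner_cvg. Qed.

Lemma deriv2_on_horner a b p : a < b ->
  {in `[a, b], deriv_on a b (deriv_on a b (horner p)) =1 horner p^`()^`()}.
Proof.
move=> ab x xab; apply: deriv_onE => //.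
apply: (@eq_diff_quotient_cvg a b (horner p^`())) => // [y yab|]; last first.
  exact: diff_quotient_horner_cvg.
by rewrite deriv_on_horner.
Qed.

Lemma horner_lipschitz a b p : a < b -> exists K,
  forall x y, a <= x -> x <= y -> y <= b -> `|p.[y] - p.[x]| <= K * (y - x).
Proof.
move=> ab; have [K pK] := horner_bounded a b p^`(); exists K.
apply: (@differentiable_on_lipschitz a b); first exact: differentiable_on_horner.
move=> x xab.
by rewrite deriv_on_horner ?in_itv// pK.
Qed.

End deriv_on.

(** * The quadrature error *)
Section quadrature_error.
Context {R : realType}.
Implicit Types (a b c : R) (f u v : R -> R) (phi p q : {poly R}).
Notation mu := (@lebesgue_measure R).

(** * Square-integrable functions on an interval *)

Lemma L2norm_sqrte a b u :
  L2norm a b u = sqrte (\int[mu]_(x in `[a, b]) (u x ^+ 2)%:E).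
Proof.
rewrite /L2norm unlock poweR12_sqrt; last by apply: integral_ge0 => x _; exact: poweR_ge0.
congr sqrte; rewrite [RHS]integral_mkcond; apply: eq_integral => x _.
rewrite [RHS]patchE /= patchE; case: ifPn => _.
  by rewrite powR_mulrn// real_normK// num_real.
by rewrite normr0 powR0.
Qed.

Lemma continuous_itv_integrable a b u : {within `[a, b], continuous u} ->
  mu.-integrable `[a, b] (EFin \o u).
Proof. by apply: continuous_compact_integrable; exact: segment_compact. Qed.

Lemma horner_integrable a b p : mu.-integrable `[a, b] (EFin \o horner p).
Proof.
by apply: continuous_itv_integrable; apply: continuous_subspaceT; exact: continuous_horner.
Qed.

Definition sqnorm a b phi : R := \int[mu]_(x in `[a, b]) (phi ^+ 2).[x].

Lemma sqnorm_ge0 a b phi : 0 <= sqnorm a b phi.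
Proof. by apply: Rintegral_ge0 => x _; rewrite horner_exp sqr_ge0. Qed.

Lemma L2norm_horner a b phi : L2norm a b (horner phi) = (Num.sqrt (sqnorm a b phi))%:E.
Proof.
rewrite L2norm_sqrte (_ : (\int[mu]_(x in `[a, b]) _)%E = (sqnorm a b phi)%:E)//.
rewrite /sqnorm /Rintegral fineK; last first.
  by apply: integrable_fin_num => //; exact: horner_integrable.
by apply: eq_integral => x _; rewrite horner_exp.
Qed.

Lemma eq_restrict a b u v : {in `[a, b], u =1 v} -> u \_ `[a, b] = v \_ `[a, b].
Proof.
move=> uv; apply/funext => x; rewrite !patchE; case: ifPn => // xab.
by apply: uv; rewrite inE in xab.
Qed.

Lemma in_L2_horner a b phi : in_L2 a b (horner phi).
Proof.
rewrite /in_L2 inE; apply/andP; split; rewrite inE/=.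
  apply/(measurable_restrictT _ _).1 => //.
  by have /integrableP[/measurable_realfun.measurable_EFinP] := horner_integrable a b phi.
by rewrite /finite_norm -[X in (X < _)%E]/(L2norm a b _) L2norm_horner ltry.
Qed.

Lemma in_L2_integrableM a b u v : in_L2 a b u -> in_L2 a b v ->
  mu.-integrable `[a, b] (EFin \o (fun x => u x * v x)).
Proof.
move=> u2 v2; have /Lfun1_integrable := Lfun2_mul_Lfun1 u2 v2.
rewrite (_ : _ \* _ = (fun x => u x * v x) \_ `[a, b]); last first.
  by apply/funext => x; rewrite /= !patchE; case: ifPn => // _; rewrite mul0r.
rewrite -restrict_EFin => /integrable_restrict; rewrite setTI; exact.
Qed.

(** Hoelder's inequality with exponents 2 and 2, applied to the extensions by zero. *)
Lemma L2_cauchy_schwarz a b u v : in_L2 a b u -> in_L2 a b v ->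
  (`|\int[mu]_(x in `[a, b]) (u x * v x)|%:E <= L2norm a b u * L2norm a b v)%E.
Proof.
move=> u2 v2; have uv := in_L2_integrableM u2 v2.
rewrite EFin_normr_Rintegral//.
apply: (@le_trans _ _ (\int[mu]_(x in `[a, b]) `|(u x * v x)%:E|)%E).
  by apply: le_abse_integral => //; exact: measurable_int uv.
move: (u2) (v2); rewrite /in_L2 !inE => /andP[/[!inE]/= mu_ _] /andP[/[!inE]/= mv _].
have h2 : 2^-1 + 2^-1 = 1 :> R by rewrite [RHS]splitr !div1r.
have := @hoelder _ _ _ mu _ _ 2 2 mu_ mv (ltr0n _ 2) (ltr0n _ 2) h2.
apply: le_trans; rewrite Lnorm1 [leLHS]integral_mkcond le_eqVlt; apply/orP; left; apply/eqP.
apply: eq_integral => x _; rewrite /= !patchE; case: ifPn => // _.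
by rewrite mul0r normr0.
Qed.

Lemma Rintegral_horner_deriv a b p : a < b ->
  \int[mu]_(x in `[a, b]) p^`().[x] = p.[b] - p.[a].
Proof.
move=> ab; rewrite /Rintegral (@continuous_FTC2 _ _ (horner p))//.
- by apply: continuous_subspaceT; exact: continuous_horner.
- split; first by move=> x _; exact: derivable_horner.
  + by apply: cvg_at_right_filter; exact: continuous_horner.
  + by apply: cvg_at_left_filter; exact: continuous_horner.
- by move=> x _; rewrite derivE.
Qed.

(** The derivative is absolutely continuous, hence bounded, so [f] is Lipschitz by the mean value
    theorem. *)
Lemma admissible_abs_cont a b f : a < b -> admissible a b f ->
  abs_cont a b f /\ abs_cont a b (deriv_on a b f).
Proof.
move=> ab [fd /absolutely_continuous_on_abs_cont gac _]; split => //.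
have [K gK] := abs_cont_bounded gac.
exact: lipschitz_abs_cont (differentiable_on_lipschitz fd gK).
Qed.

Lemma horner_abs_cont a b p : a < b -> abs_cont a b (horner p).
Proof. by move=> /(horner_lipschitz p)[K /lipschitz_abs_cont]. Qed.

Lemma abs_contM a b u v : abs_cont a b u -> abs_cont a b v ->
  abs_cont a b (fun x => u x * v x).
Proof.
move=> uac vac; have [M uM] := abs_cont_bounded uac.
have [N vN] := abs_cont_bounded vac.
apply: (@abs_contM_of_bound _ a b u v (Num.max M N)) => // x xab.
  by rewrite le_max uM.
by rewrite le_max vN// orbT.
Qed.

Lemma ae_neq (y : R) : {ae mu, forall x : R, x != y}.
Proof.
exists [set y]; split; [exact: measurable_set1|exact: lebesgue_measure_set1|].
by move=> x /= /negP; rewrite negbK => /eqP.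
Qed.

(** A single integration by parts, on [Psi]: in its derivative the two products of [g] with the
    derivative of [phi] cancel. The boundary terms of the quadrature formula are half of
    [Psi b - Psi a]. *)
Lemma quad_error_integral a b phi f : a < b -> phi^`()^`() = 2%:P ->
  admissible a b f ->
  quad_error a b phi f =
  2^-1 * \int[mu]_(x in `[a, b]) (deriv_on a b (deriv_on a b f) x * phi.[x]).
Proof.
move=> ab phi2 adf; have [fac gac] := admissible_abs_cont ab adf.
have [fd _ g2] := adf; set g := deriv_on a b f; set k := deriv_on a b g.
pose Psi x := f x * phi^`().[x] - g x * phi.[x].
have Psiac : abs_cont a b Psi.
  by apply: abs_contB; apply: abs_contM => //; exact: horner_abs_cont.
have [h [hi hE hae]] := abs_cont_FTC ab Psiac.
have [l [_ _ lae]] := abs_cont_FTC ab gac.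
have fi : mu.-integrable `[a, b] (EFin \o f).
  by apply: continuous_itv_integrable; exact: differentiable_on_continuous.
have ki : mu.-integrable `[a, b] (EFin \o (fun x => k x * phi.[x])).
  by apply: in_L2_integrableM => //; exact: in_L2_horner.
have f2i : mu.-integrable `[a, b] (EFin \o (fun x => 2 * f x)).
  rewrite (_ : EFin \o _ = (fun x => 2%:E * (EFin \o f) x)%E)//.
  exact: integrableZl.
(* At almost every point both integrands are the derivative of [Psi]: the left one by the
   fundamental theorem, the right one by the product rule. *)
have hkE : \int[mu]_(x in `[a, b]) h x = \int[mu]_(x in `[a, b]) (2 * f x - k x * phi.[x]).
  rewrite /Rintegral; congr fine; apply: ae_eq_integral => //.
  - exact: measurable_int hi.
  - by apply: (measurable_int mu); apply: integrableB f2i ki.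
  have aeF := ae_filter_ringOfSetsType mu.
  near=> x.
  rewrite /= in_itv/= => /andP[ax xb].
  have xoo : x \in `]a, b[.
    rewrite in_itv/= !lt_neqAle ax xb !andbT eq_sym.
    by apply/andP; split; near: x; exact: ae_neq.
  have hx : is_derive x 1 Psi (h x) by move: xoo; near: x.
  have lx : is_derive x 1 g (l x) by move: xoo; near: x.
  (* Where [g] is differentiable the limit defining [k x] exists, so [k x] is not a default
     value. *)
  have kE : k x = l x.
    apply: deriv_onE => //; first exact: subset_itv_oo_cc.
    exact: is_derive_diff_quotient_cvg.
  have fx : is_derive x 1 f (g x) by exact: differentiable_on_is_derive.
  have Px : is_derive x 1 Psi
      ((f x *: 2 + phi^`().[x] *: g x) - (g x *: phi^`().[x] + phi.[x] *: l x)).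
    have p2 : is_derive x 1 (horner phi^`()) 2.
      have : is_derive x (1 : R) (horner phi^`()) phi^`()^`().[x] by exact: _.
      by rewrite phi2 hornerC.
    by apply: is_deriveB.
  have := @derive_val _ _ _ _ _ _ _ Px; rewrite (@derive_val _ _ _ _ _ _ _ hx) => ->.
  rewrite kE /GRing.scale/=.
  by congr EFin; ring.
have H : 2 * \int[mu]_(x in `[a, b]) f x - \int[mu]_(x in `[a, b]) (k x * phi.[x]) =
    Psi b - Psi a.
  by rewrite -hE hkE RintegralB// RintegralZl.
rewrite /quad_error -/g; move: H; rewrite /Psi.
move: (\int[mu]_(x in `[a, b]) f x) (\int[mu]_(x in `[a, b]) (k x * phi.[x])) => I J H.
have -> : J = 2 * I - (f b * phi^`().[b] - g b * phi.[b] -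
  (f a * phi^`().[a] - g a * phi.[a])) by rewrite -H; ring.
by field.
Unshelve. all: by end_near. Qed.

Lemma quad_error_le a b phi f : a < b -> phi^`()^`() = 2%:P -> admissible a b f ->
  (`|quad_error a b phi f|%:E <=
   L2norm_deriv2 a b f * (2^-1 * Num.sqrt (sqnorm a b phi))%:E)%E.
Proof.
move=> ab phi2 adf; rewrite (quad_error_integral ab phi2 adf).
rewrite normrM ger0_norm ?invr_ge0// EFinM.
have [_ _ k2] := adf.
rewrite [in leRHS]EFinM muleCA -L2norm_horner lee_wpmul2l ?lee_fin ?invr_ge0//.
by apply: L2_cauchy_schwarz => //; exact: in_L2_horner.
Qed.

(** Applied twice, it yields functions whose second derivative is a multiple of [phi], the equality
    case of Cauchy-Schwarz. *)
Lemma poly_antiderivative p : exists q, q^`() = p.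
Proof.
(* At [i = 0] the division by zero gives 0, which serves as the constant term. *)
exists (\poly_(i < (size p).+1) (p`_i.-1 / i%:R)); apply/polyP => i.
rewrite coef_deriv coef_poly ltnS; case: ltnP => [_|ip].
  by rewrite -[LHS]mulr_natr /= divfK// pnatr_eq0.
by rewrite mul0rn nth_default.
Qed.

Lemma admissible_horner a b p : a < b -> admissible a b (horner p).
Proof.
move=> ab; split; first exact: differentiable_on_horner.
  have [K pK] := horner_lipschitz p^`() ab.
  apply: (@lipschitz_absolutely_continuous_on _ _ _ _ K) => x y ax xy yb.
  by rewrite !deriv_on_horner ?pK// in_itv/= ?ax ?yb ?(le_trans xy)// (le_trans ax).
rewrite /in_L2 (eq_restrict (deriv2_on_horner p ab)); exact: in_L2_horner.
Qed.

Lemma L2norm_deriv2_horner a b p : a < b ->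
  L2norm_deriv2 a b (horner p) = (Num.sqrt (sqnorm a b p^`()^`()))%:E.
Proof.
move=> ab; rewrite /L2norm_deriv2 /L2norm (eq_restrict (deriv2_on_horner p ab)).
exact: L2norm_horner.
Qed.

Lemma quad_error_horner a b phi p : a < b -> phi^`()^`() = 2%:P ->
  quad_error a b phi (horner p) =
  2^-1 * \int[mu]_(x in `[a, b]) (p^`()^`() * phi).[x].
Proof.
move=> ab phi2; rewrite quad_error_integral//; last exact: admissible_horner.
congr (_ * _); apply: eq_Rintegral => x; rewrite inE/= => xab.
by rewrite deriv2_on_horner// hornerM.
Qed.

Lemma sqnormZ a b phi (r : R) : sqnorm a b (r *: phi) = r ^+ 2 * sqnorm a b phi.
Proof.
rewrite /sqnorm -RintegralZl//; last exact: horner_integrable.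
by apply: eq_Rintegral => x _; rewrite !horner_exp hornerZ exprMn.
Qed.

Lemma K2E a b phi : a < b -> phi^`()^`() = 2%:P -> 0 < sqnorm a b phi ->
  K2 a b phi = (2^-1 * Num.sqrt (sqnorm a b phi))%:E.
Proof.
move=> ab phi2 N0; apply/eqP; rewrite eq_le; apply/andP; split.
  apply: ge_ereal_sup => _ [f [adf f1] <-].
  apply: le_trans (quad_error_le ab phi2 adf) _.
  rewrite -[leRHS]mul1e lee_wpmul2r// lee_fin mulr_ge0 ?invr_ge0//.
set N := Num.sqrt _; have N0' : 0 < N by rewrite sqrtr_gt0.
have NN : sqnorm a b phi = N ^+ 2 by rewrite sqr_sqrtr// ltW.
(* The extremal function [q] has second derivative [phi / N], of norm 1, and its error is
   [N / 2]. *)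
have [q1 q1E] := poly_antiderivative (N^-1 *: phi).
have [q qE] := poly_antiderivative q1.
apply: ereal_sup_ubound; exists (horner q).
  split; first exact: admissible_horner.
  rewrite L2norm_deriv2_horner// qE q1E sqnormZ NN exprVn mulVf ?sqrtr1//.
  by rewrite expf_neq0// gt_eqF.
rewrite quad_error_horner// qE q1E; congr EFin.
have -> : \int[mu]_(x in `[a, b]) (N^-1 *: phi * phi).[x] = N.
  transitivity (N^-1 * sqnorm a b phi); last by rewrite NN expr2 mulKf// gt_eqF.
  rewrite /sqnorm -RintegralZl//; last exact: horner_integrable.
  by apply: eq_Rintegral => x _; rewrite -scalerAl hornerZ expr2.
by rewrite ger0_norm// mulr_ge0 ?invr_ge0// ltW.
Qed.

End quadrature_error.

(** * Minimization over monic quadratics *)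
Section monic_quadratic.
Context {R : realType}.
Implicit Types (a b c p q : R) (phi : {poly R}).

(** Coordinates centered at [c]: when [c] is the midpoint of the interval, [p] and [q] decouple in
    the squared norm. *)
Definition centered_quadratic c p q : {poly R} :=
  ('X - c%:P) ^+ 2 + p%:P * ('X - c%:P) + q%:P.

Lemma horner_centered_quadratic c p q (x : R) :
  (centered_quadratic c p q).[x] = (x - c) ^+ 2 + p * (x - c) + q.
Proof. by rewrite /centered_quadratic !(hornerE, horner_exp). Qed.

Lemma deriv_centered_quadratic c p q :
  (centered_quadratic c p q)^`() = 2%:P * ('X - c%:P) + p%:P.
Proof.
rewrite /centered_quadratic !poly.derivE /= polyCMn; ring.
Qed.

Lemma deriv2_centered_quadratic c p q : (centered_quadratic c p q)^`()^`() = 2%:P.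
Proof. by rewrite deriv_centered_quadratic !poly.derivE /=; ring. Qed.

Lemma centered_quadratic_monic c p q : monic_quadratic (centered_quadratic c p q).
Proof.
have s2 : size (('X - c%:P) ^+ 2)%R = 3%N by rewrite size_exp_XsubC.
have s1 : (size (p%:P * ('X - c%:P) + q%:P)%R < 3)%N.
  rewrite (leq_ltn_trans (size_polyD _ _))// gtn_max.
  rewrite (leq_ltn_trans (size_polyC_leq1 _))// andbT.
  by rewrite mul_polyC (leq_ltn_trans (size_scale_leq _ _))// size_XsubC.
rewrite /monic_quadratic /centered_quadratic -addrA size_polyDl ?s2//; split=> //.
by rewrite monicE lead_coefDl ?s2// -monicE monic_exp// monicXsubC.
Qed.

Lemma monic_quadratic_centered c phi : monic_quadratic phi ->
  exists p q, phi = centered_quadratic c p q.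
Proof.
(* Taylor coefficients at [c]: the derivative of [phi] at [c], and [phi] at [c]. *)
case=> /eqP lc sz; exists (phi`_1 + 2 * c), (phi`_0 + phi`_1 * c + c ^+ 2).
have E : phi = 'X ^+ 2 + (phi`_1)%:P * 'X + (phi`_0)%:P.
  rewrite -[LHS]coefK sz poly_def !big_ord_recl big_ord0 /= /bump/= addr0.
  move: lc; rewrite lead_coefE sz /= => ->.
  by rewrite !addn0 expr0 expr1 scale1r alg_polyC mul_polyC [LHS]addrC (addrC _ 'X^2).
rewrite [LHS]E /centered_quadratic !(polyCD, polyCM, polyC_exp, polyCMn); ring.
Qed.

(** Odd powers of [x - c] integrate to zero by symmetry, and completing the square in [q] leaves
    [2/5 - 2/9 = 8/45] as the coefficient of [h ^+ 5]. *)
Lemma sqnorm_centered_quadratic a b p q : a < b ->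
  let h := (b - a) / 2 in
  sqnorm a b (centered_quadratic ((a + b) / 2) p q) =
  8 / 45 * h ^+ 5 + 2 / 3 * h ^+ 3 * p ^+ 2 + 2 * h * (q + h ^+ 2 / 3) ^+ 2.
Proof.
move=> ab h; pose c := (a + b) / 2.
(* Antiderivative of the squared polynomial, term by term in powers of [x - c]. *)
pose F : {poly R} := 5^-1 *: ('X - c%:P) ^+ 5 + (p / 2) *: ('X - c%:P) ^+ 4 +
  ((p ^+ 2 + 2 * q) / 3) *: ('X - c%:P) ^+ 3 + (p * q) *: ('X - c%:P) ^+ 2 +
  (q ^+ 2) *: ('X - c%:P).
have FE x : F.[x] = 5^-1 * (x - c) ^+ 5 + p / 2 * (x - c) ^+ 4 +
    (p ^+ 2 + 2 * q) / 3 * (x - c) ^+ 3 + p * q * (x - c) ^+ 2 + q ^+ 2 * (x - c).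
  by rewrite /F 4!hornerD !hornerZ !horner_exp !hornerXsubC.
transitivity (\int[@lebesgue_measure R]_(x in `[a, b]) F^`().[x]).
  apply: eq_Rintegral => x _; rewrite horner_exp horner_centered_quadratic -/c.
  by rewrite /F !poly.derivE !(hornerE, horner_exp) /=; field.
have bc : b - c = h by rewrite /c /h; field.
have ac : a - c = - h by rewrite /c /h; field.
by rewrite Rintegral_horner_deriv// !FE bc ac; move: @h {bc ac} => h; field.
Qed.

Lemma sqnorm_centered_quadratic_gt0 a b p q : a < b ->
  0 < sqnorm a b (centered_quadratic ((a + b) / 2) p q).
Proof.
move=> ab; rewrite sqnorm_centered_quadratic//.
have h0 : 0 < (b - a) / 2 by rewrite divr_gt0// subr_gt0.
have h0' := ltW h0.
rewrite -addrA; move: ((b - a) / 2) h0 h0' => h h0 h0'; apply: ltr_pwDl.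
  by rewrite mulr_gt0 ?divr_gt0 ?exprn_gt0.
by apply: addr_ge0; apply: mulr_ge0 (sqr_ge0 _); rewrite mulr_ge0 ?divr_ge0 ?exprn_ge0.
Qed.

Lemma optimal_constantE a b q : a < b -> q = - ((b - a) ^+ 2 / 12) ->
  2^-1 * Num.sqrt (sqnorm a b (centered_quadratic ((a + b) / 2) 0 q)) =
  (b - a) `^ (5 / 2) / (12 * Num.sqrt 5).
Proof.
move=> ab ->; rewrite sqnorm_centered_quadratic//.
have ba0 : 0 <= b - a by rewrite subr_ge0 ltW.
rewrite powRrM powR12_sqrt ?powR_ge0// powR_mulrn//.
have s2 : Num.sqrt ((b - a) ^+ 5) ^+ 2 = (b - a) ^+ 5 by rewrite sqr_sqrtr// exprn_ge0.
have t2 : Num.sqrt 5 ^+ 2 = 5 :> R by rewrite sqr_sqrtr.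
have t0 : 0 < Num.sqrt 5 :> R by rewrite sqrtr_gt0.
have s0 : 0 <= Num.sqrt ((b - a) ^+ 5) by exact: sqrtr_ge0.
move: (Num.sqrt ((b - a) ^+ 5)) (Num.sqrt 5) s2 t2 t0 s0 => s t s2 t2 t0 s0.
(* Only [8/45 * h ^+ 5] survives; it equals [(b - a) ^+ 5 / 180], and [180 = 6 ^ 2 * 5]. *)
rewrite (_ : _ + _ = (s / (6 * t)) ^+ 2).
  rewrite sqrtr_sqr ger0_norm ?divr_ge0 ?mulr_ge0 ?(ltW t0)//.
  by field; rewrite gt_eqF.
by rewrite [RHS]expr_div_n [in RHS]exprMn s2 t2; field.
Qed.

End monic_quadratic.

(** * Optimality of the quadrature formula *)

Unset Implicit Arguments.

Theorem corollary2p3 (R : realType) (a b : R) (hab : a < b) :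
  let c : R := (a + b) / 2 in
  let beta2 : R := Num.sqrt 3 in
  let alpha2 : R := (b - a) / (2 * beta2) in
  let phi : {poly R} := ('X - c%:P) ^+ 2 - (alpha2 ^+ 2)%:P in
  let C0 : R := (b - a) `^ (5 / 2) / (12 * Num.sqrt 5) in
  [/\ unique (K2_minimizer a b) phi,
      forall f : R -> R, admissible a b f ->
        \int[@lebesgue_measure R]_(x in `[a, b]) f x =
          (b - a) / 2 * (f a + f b)
          + (b - a) ^+ 2 / 12 * (deriv_on a b f a - deriv_on a b f b)
          + quad_error a b phi f /\
        (`|quad_error a b phi f|%:E <= L2norm_deriv2 a b f * C0%:E)%E &
      forall C : R, C < C0 ->
        ~ (forall f : R -> R, admissible a b f ->
            (`|quad_error a b phi f|%:E <= L2norm_deriv2 a b f * C%:E)%E)].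
Proof.
move=> c beta2 alpha2 phi C0.
have al2 : alpha2 ^+ 2 = (b - a) ^+ 2 / 12.
  by rewrite /alpha2 expr_div_n exprMn sqr_sqrtr//; field.
pose q0 := - ((b - a) ^+ 2 / 12).
have phiE : phi = centered_quadratic c 0 q0.
  by rewrite /phi al2 /centered_quadratic mul0r addr0 polyCN.
have C0E : 2^-1 * Num.sqrt (sqnorm a b phi) = C0.
  by rewrite phiE; exact: optimal_constantE.
have phi2 : phi^`()^`() = 2%:P by rewrite phiE deriv2_centered_quadratic.
have N0 : 0 < sqnorm a b phi by rewrite phiE; exact: sqnorm_centered_quadratic_gt0.
have h0 : 0 < (b - a) / 2 by rewrite divr_gt0// subr_gt0.
have K2q p q : K2 a b (centered_quadratic c p q) =
    (2^-1 * Num.sqrt (sqnorm a b (centered_quadratic c p q)))%:E.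
  apply: K2E => //; first exact: deriv2_centered_quadratic.
  exact: sqnorm_centered_quadratic_gt0.
(* Excess of the squared norm over its value at [phi]: two nonnegative terms, vanishing together
   only for [p = 0] and [q = q0]. *)
have gap p q : sqnorm a b (centered_quadratic c p q) = sqnorm a b phi +
    (2 / 3 * ((b - a) / 2) ^+ 3 * p ^+ 2 + (b - a) * (q - q0) ^+ 2).
  by rewrite phiE !sqnorm_centered_quadratic// /q0; field.
have gap1 p : 0 <= 2 / 3 * ((b - a) / 2) ^+ 3 * p ^+ 2.
  by apply: mulr_ge0 (sqr_ge0 _); rewrite mulr_ge0 ?divr_ge0// exprn_ge0// ltW.
have gap2 q : 0 <= (b - a) * (q - q0) ^+ 2.
  by apply: mulr_ge0 (sqr_ge0 _); rewrite subr_ge0 ltW.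
have phim : monic_quadratic phi by rewrite phiE; exact: centered_quadratic_monic.
split.
- split.
    split=> // psi /(monic_quadratic_centered c)[p [q ->]].
    rewrite [in leLHS]phiE !K2q -phiE lee_fin ler_pM2l ?invr_gt0// ler_wsqrtr// gap lerDl.
    by rewrite addr_ge0.
  (* Uniqueness: a minimizer compared with [phi] has excess at most 0, so both terms vanish. *)
  move=> psi [/(monic_quadratic_centered c)[p [q ->]]] /(_ _ phim).
  rewrite phiE !K2q lee_fin ler_pM2l ?invr_gt0// ler_sqrt ?sqnorm_ge0// (gap p q) -phiE gerDl.
  move=> gle0; move: (gap1 p) (gap2 q) => g1 g2.
  have /eqP : 2 / 3 * ((b - a) / 2) ^+ 3 * p ^+ 2 = 0 by lra.
  have /eqP : (b - a) * (q - q0) ^+ 2 = 0 by lra.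
  have K0 : 0 < 2 / 3 * ((b - a) / 2) ^+ 3 by apply: mulr_gt0; [exact: divr_gt0|exact: exprn_gt0].
  rewrite mulf_eq0 sqrf_eq0 gt_eqF ?subr_gt0//= subr_eq0 => /eqP ->.
  by rewrite mulf_eq0 sqrf_eq0 (gt_eqF K0)/= => /eqP ->.
- move=> f adf; split; last by rewrite -C0E; exact: quad_error_le.
  rewrite /quad_error phiE deriv_centered_quadratic !horner_centered_quadratic.
  by rewrite !hornerD !hornerM !hornerXsubC !hornerC /q0 /c; field.
- move=> C CC0 H; move: CC0; apply/negP; rewrite -leNgt -C0E.
  (* Sharpness is tested on a [q] with second derivative [phi]: its error is half the square of the
     norm of [phi], and dividing by that norm gives [C0 <= C]. *)
  have [q1 q1E] := poly_antiderivative phi; have [q qE] := poly_antiderivative q1.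
  have := H _ (admissible_horner q hab).
  rewrite L2norm_deriv2_horner// quad_error_horner// qE q1E -expr2.
  rewrite -[\int[_]_(_ in _) _]/(sqnorm a b phi) -EFinM lee_fin.
  rewrite ger0_norm ?mulr_ge0 ?invr_ge0// ?sqnorm_ge0//.
  rewrite -[sqnorm _ _ _ in X in X <= _]sqr_sqrtr ?sqnorm_ge0//.
  by rewrite expr2 mulrA mulrC ler_pM2l ?sqrtr_gt0.
Qed.
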